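(* Let $\mathcal{H}$ be a real Hilbert space, let $A,B:\mathcal{H}\rightrightarrows\mathcal{H}$ be two maximally monotone operators and let $T:\mathcal{H}\to\mathcal{H}$ be a $\beta$-cocoercive operator, with $\beta>0$, such that $\operatorname{zer}(A+B+T)\neq\emptyset$. Let $\gamma\in{]0,4\beta[}$ and let $(\lambda_k)_{k\in\mathbb{N}}$ be a sequence in $]0,2-\gamma/(2\beta)]$ such that $\sum_{k\in\mathbb{N}}\lambda_k\left(2-\frac{\gamma}{2\beta}-\lambda_k\right)=+\infty$. Given $x_0\in\mathcal{H}$, consider the sequences defined for $k=0,1,2,\ldots$ by $$u_k=J_{\gamma A}(x_k),\qquad v_k=J_{\gamma B}\bigl(2u_k-x_k-\gamma T(u_k)\bigr),\qquad x_{k+1}=x_k+\lambda_k(v_k-u_k).$$ Let $$\Omega_\gamma:=\bigl\{x\in\mathcal{H}: J_{\gamma A}(x)=J_{\gamma B}\bigl(2J_{\gamma A}(x)-x-\gamma T(J_{\gamma A}(x))\bigr)\bigr\}.$$ Then the sequence $(x_k)_{k\in\mathbb{N}}$ is Fejér monotone with respect to $\Omega_\gamma$. Moreover, the following assertions hold: (i) There exist $\bar{x}\in\Omega_\gamma$ and $\bar{u}\in\mathcal{H}$ such that $x_k\rightharpoonup\bar{x}$, $u_k\rightharpoonup\bar{u}$, $v_k\rightharpoonup\bar{u}$, $v_k-u_k\to 0$ and $T(u_k)\to T(\bar{u})$, with $$\bar{u}=J_{\gamma A}(\bar{x})=J_{\gamma B}\bigl(2\bar{u}-\bar{x}-\gamma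 T(\bar{u})\bigr)\in\operatorname{zer}(A+B+T).$$ Further, $T\bigl(\operatorname{zer}(A+B+T)\bigr)=\{T(\bar{u})\}$. (ii) If either $A$ or $B$ is uniformly monotone on every bounded subset of its domain, or $T$ is demiregular at every point in $\operatorname{zer}(A+B+T)$, then $(u_k)_{k\in\mathbb{N}}$ and $(v_k)_{k\in\mathbb{N}}$ converge strongly to $\bar{u}\in\operatorname{zer}(A+B+T)$.
   Context: $\mathcal{H}$ is a real Hilbert space with inner product $\langle\cdot,\cdot\rangle$ and norm $\|\cdot\|$; $\to$ denotes norm convergence and $\rightharpoonup$ weak convergence. A set-valued operator $A:\mathcal{H}\rightrightarrows\mathcal{H}$ assigns to each $x\in\mathcal{H}$ a subset $A(x)\subseteq\mathcal{H}$; $\operatorname{gra}A=\{(x,u):u\in A(x)\}$, $\operatorname{dom}A=\{x:A(x)\neq\emptyset\}$, $\operatorname{zer}A=\{x:0\in A(x)\}$. $A$ is monotone if $\langle x-y,u-v\rangle\geq 0$ for all $(x,u),(y,v)\in\operatorname{gra}A$, and maximally monotone if in addition no monotone operator has a graph properly containing $\operatorname{gra}A$. The resolvent of $A$ with parameter $\gamma>0$ is $J_{\gamma A}:=(\operatorname{Id}+\gamma A)^{-1}$; for $A$ maximally monotone it is single-valued with domain $\mathcal{H}$. $T:\mathcal{H}\to\mathcal{H}$ is $\beta$-cocoercive if $\langle x-y,T(x)-T(y)\rangle\geq\beta\|T(x)-T(y)\|^2$ for all $x,y\in\mathcal{H}$. $A$ is uniformly monotone with modulus $\phi:\mathbb{R}_+\to[0,+\infty[$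 if $\phi$ is increasing, vanishes only at $0$, and $\langle x-y,u-v\rangle\geq\phi(\|x-y\|)$ for all $(x,u),(y,v)\in\operatorname{gra}A$. $A$ is uniformly monotone on every bounded subset of its domain if for every bounded $C\subseteq\operatorname{dom}A$ there is such a function $\phi$ (depending on $C$) for which the inequality holds for all $(x,u),(y,v)\in\operatorname{gra}A$ with $x,y\in C$. $T:\mathcal{H}\to\mathcal{H}$ is demiregular at $x\in\mathcal{H}$ if for all sequences $(x_k)_{k\in\mathbb{N}}$ with $x_k\rightharpoonup x$ and $T(x_k)\to T(x)$, we have $x_k\to x$. A sequence $(x_k)_{k\in\mathbb{N}}$ is Fejér monotone with respect to a nonempty set $C\subseteq\mathcal{H}$ if $\|x_{k+1}-x\|\leq\|x_k-x\|$ for all $x\in C$ and all $k\in\mathbb{N}$. *)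

(* Defs.v *)
From mathcomp Require Import all_boot all_order all_algebra.
From mathcomp Require Import all_classical all_reals all_analysis.

Set Implicit Arguments.
Unset Strict Implicit.
Unset Printing Implicit Defensive.

Import Order.TTheory GRing.Theory Num.Theory.
Import numFieldNormedType.Exports.

Local Open Scope classical_set_scope.
Local Open Scope ring_scope.

(* A set-valued operator on H is a function [A : H -> set H]. *)
Section SetValuedOperators.
Context {R : realType} {H : normedModType R}.
Implicit Types (A B : H -> set H) (T : H -> H).

Definition gra A : set (H * H) := [set p | A p.1 p.2].

Definition dom A : set H := [set x | A x !=set0].

Definition zer A : set H := [set x | A x 0].

Definition op_of_fun T : H -> set H := fun x => [set T x].

Definition op_add A B : H -> set H :=
  fun x => [set a + b | a in A x & b in B x].

Definition op_scale (c : R) A : H -> set H :=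
  fun x => [set c *: a | a in A x].

Definition op_inv A : H -> set H := fun u => [set x | A x u].

Definition resolvent (c : R) A : H -> set H :=
  op_inv (op_add (op_of_fun idfun) (op_scale c A)).

(* The resolvent as a function: when [resolvent c A x] is a singleton (as it is
   for every x if A is maximally monotone and 0 < c), this is its element; the
   default value 0 is only used when [resolvent c A x] is empty. *)
Definition J (c : R) A (x : H) : H := xget 0 (resolvent c A x).

Definition Omega (c : R) A B T : set H :=
  [set x | J c A x = J c B (2 *: J c A x - x - c *: T (J c A x))].

Definition fejer_monotone (x : nat -> H) (C : set H) : Prop :=
  C !=set0 /\ forall c, C c -> forall k, `|x k.+1 - c| <= `|x k - c|.

(* "Increasing" is understood in the non-strict sense. *)
Definition modulus (phi : R -> R) : Prop :=
  [/\ forall t, 0 <= t -> 0 <= phi t,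
      forall s t, 0 <= s -> s <= t -> phi s <= phi t &
      forall t, 0 <= t -> (phi t = 0 <-> t = 0)].

End SetValuedOperators.

(* [{dot H for idfun}] is the type of symmetric positive definite bilinear forms
   on H. Nothing here relates [ip] to the norm of H: for H to be a Hilbert space,
   [ip x x = `|x| ^+ 2] must be assumed separately. *)
Section InnerProduct.
Context {R : realType} {H : normedModType R}.
Variable ip : {dot H for idfun}.
Implicit Types (A : H -> set H) (T : H -> H).

Definition monotone A : Prop :=
  forall x y u v, A x u -> A y v -> 0 <= ip (x - y) (u - v).

Definition maximally_monotone A : Prop :=
  monotone A /\ forall B, monotone B -> ~ (gra A `<` gra B).

Definition cocoercive (beta : R) T : Prop :=
  forall x y, beta * `|T x - T y| ^+ 2 <= ip (x - y) (T x - T y).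

Definition uniformly_monotone_on_bounded A : Prop :=
  forall C : set H, bounded_set C -> C `<=` dom A ->
    exists2 phi : R -> R, modulus phi &
      forall x y u v, C x -> C y -> A x u -> A y v ->
        phi `|x - y| <= ip (x - y) (u - v).

Definition weakly_cvg (x : nat -> H) (l : H) : Prop :=
  forall y, ip (x k) y @[k --> \oo] --> ip l y.

Definition demiregular T (l : H) : Prop :=
  forall x : nat -> H,
    weakly_cvg x l -> T (x k) @[k --> \oo] --> T l -> x @ \oo --> l.

End InnerProduct.

(* Main.v *)
Require Import Defs.
From mathcomp Require Import all_boot all_order all_algebra.
From mathcomp Require Import all_classical all_reals all_analysis.
From mathcomp Require Import ring lra.

Import Order.TTheory GRing.Theory Num.Theory.
Import numFieldNormedType.Exports.

Local Open Scope classical_set_scope.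
Local Open Scope ring_scope.

(* Let D = U - V be the residual, where U = J_{gamma A} and V is the backward
   step of B. Adding the firm nonexpansiveness of the two resolvents to the
   cocoercivity of T yields, for all x and y,
     (2 - gamma / (2 beta)) |D x - D y|^2 <= 2 <x - y, D x - D y>.
   Taking y in Omega (D y = 0) this gives Fejer monotonicity with a summable
   decrease lambda_k (2 - gamma / (2 beta) - lambda_k) |D x_k|^2; taking
   consecutive iterates it shows that |D x_k| is nonincreasing, so D x_k -> 0
   by the divergence of the series, and then T u_k -> T (U y). Weak limits are
   taken along ultrafilters finer than [\oo]: each of them lies in Omega, and
   Fejer monotonicity makes them all equal (Opial). For strong convergence, the
   slack in each of the two resolvent inequalities tends to 0, and this slack
   dominates the modulus of uniform monotonicity.
   That the resolvents are everywhere defined (Minty) and that bounded families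
   have weak limits (Riesz) both follow from minimising a quadratically
   regularised convex epigraph, which only uses completeness. *)

Section HilbertSpace.
Set Implicit Arguments.
Unset Strict Implicit.
Context {R : realType} {H : completeNormedModType R} {ip : {dot H for idfun}}.

(** * Inner product calculus and Cauchy-Schwarz *)

Lemma ipC (x y : H) : ip x y = ip y x.
Proof. by rewrite hermC /= expr0 mul1r. Qed.

Lemma ipDl (x y z : H) : ip (x + y) z = ip x z + ip y z.
Proof. by rewrite linearDl. Qed.

Lemma ipDr (x y z : H) : ip x (y + z) = ip x y + ip x z.
Proof. by rewrite linearDr. Qed.

Lemma ipNl (x z : H) : ip (- x) z = - ip x z.
Proof. by rewrite linearNl. Qed.

Lemma ipNr (x z : H) : ip x (- z) = - ip x z.
Proof. by rewrite linearNr. Qed.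

Lemma ipZl (a : R) (x z : H) : ip (a *: x) z = a * ip x z.
Proof. by rewrite linearZl_LR. Qed.

Lemma ipZr (a : R) (x z : H) : ip x (a *: z) = a * ip x z.
Proof. by rewrite linearZr_LR. Qed.

Lemma ip0l (x : H) : ip 0 x = 0.
Proof. by rewrite linear0l. Qed.

Lemma ip0r (x : H) : ip x 0 = 0.
Proof. by rewrite linear0r. Qed.

Definition ipE := (ipDl, ipDr, ipNl, ipNr, ipZl, ipZr).

Context (ip_norm : forall x : H, ip x x = `|x| ^+ 2).

Lemma ip_ge0 (x : H) : 0 <= ip x x.
Proof. by rewrite ip_norm exprn_ge0. Qed.

Lemma ip_eq0 (x : H) : ip x x <= 0 -> x = 0.
Proof.
rewrite ip_norm => h; apply/normr0_eq0/eqP; rewrite -sqrf_eq0 eq_le h.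
exact: exprn_ge0.
Qed.

Lemma ip_inj (x y : H) : (forall z, ip x z = ip y z) -> x = y.
Proof.
move=> h; apply/eqP; rewrite -subr_eq0; apply/eqP/ip_eq0.
by rewrite ipDl ipNl h subrr.
Qed.

(** Cauchy-Schwarz: the square of [|y| x - |x| y] expands to [2 |x||y| (|x||y| - ip x y)], and the
    positive factor cancels. *)
Lemma ip_le (x y : H) : ip x y <= `|x| * `|y|.
Proof.
have [->|y0] := eqVneq y 0; first by rewrite ip0r normr0 mulr0.
have y_gt0 : 0 < `|y| by rewrite normr_gt0.
have := ip_ge0 (`|y| *: x - `|x| *: y); rewrite !ipE !ip_norm (ipC y x) => h.
have [->|x0] := eqVneq x 0; first by rewrite ip0l normr0 mul0r.
have x_gt0 : 0 < `|x| by rewrite normr_gt0.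
have : 0 <= (`|x| * `|y|) * (`|x| * `|y| - ip x y) by lra.
by rewrite pmulr_rge0 ?mulr_gt0 // subr_ge0.
Qed.

Lemma ip_norm_le (x y : H) : `|ip x y| <= `|x| * `|y|.
Proof.
by rewrite ler_norml ip_le andbT lerNl -ipNl (le_trans (ip_le _ _)) ?normrN.
Qed.

(** Polarisation writes [ip] through norms, whose continuity is known. *)
Lemma cvg_ip (T : Type) (F : set_system T) {FF : Filter F}
    (f g : T -> H) (a b : H) :
  f @ F --> a -> g @ F --> b -> ip (f t) (g t) @[t --> F] --> ip a b.
Proof.
move=> fa gb.
have polar (x y : H) : ip x y = (`|x + y| ^+ 2 - `|x - y| ^+ 2) / 4.
  rewrite -!ip_norm !ipE (ipC y x); lra.
rewrite polar; under eq_fun do rewrite polar.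
apply: cvgMl; apply: cvgB; rewrite expr2; under eq_fun do rewrite expr2.
  by apply: cvgM; apply: cvg_norm; exact: cvgD.
by apply: cvgM; apply: cvg_norm; exact: cvgB.
Qed.

(** * Existence of minimisers from completeness *)

Lemma cvg_of_sqr_dist (z : nat -> H) (c : R) :
    (forall i j, ip (z i - z j) (z i - z j) <= c * (i.+1%:R^-1 + j.+1%:R^-1)) ->
  exists l : H, z @ \oo --> l.
Proof.
move=> hz; apply/cvg_ex; apply: cauchy_cvg; apply: cauchy_exP => e e0.
have c0 : 0 <= c.
  have := hz 0 1; have := ip_ge0 (z 0 - z 1) => h1 h2.
  have : 0 <= c * (1%:R^-1 + 2%:R^-1) by exact: le_trans h2.
  by rewrite pmulr_lge0 // addr_gt0 ?invr_gt0.
have [N hN] : exists N : nat, 2 * c / e ^+ 2 < N.+1%:R.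
  exists (Num.truncn (2 * c / e ^+ 2)); exact: truncnS_gt.
exists (z N); exists N => // n /= Nn.
rewrite -ball_normE /=.
suff : ip (z N - z n) (z N - z n) < e ^+ 2.
  by rewrite ip_norm ltr_pXn2r ?nnegrE // ltW.
apply: le_lt_trans (hz _ _) _.
have hn : n.+1%:R^-1 <= N.+1%:R^-1 :> R by rewrite lef_pV2 ?posrE // ler_nat.
have : c * (N.+1%:R^-1 + n.+1%:R^-1) <= 2 * c / N.+1%:R.
  have -> : 2 * c / N.+1%:R = c * (N.+1%:R^-1 + N.+1%:R^-1) by ring.
  by rewrite ler_wpM2l // lerD2l.
move/le_lt_trans; apply.
by rewrite ltr_pdivrMr // [ltRHS]mulrC -ltr_pdivrMr ?exprn_gt0.
Qed.

(* [E] stands for the epigraph of a closed convex function on [H * H]; the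
   conclusion is the first-order condition at the minimiser of that function
   plus half the squared norm. *)
Lemma regularized_min (E : H -> H -> R -> Prop) (m : R) :
    (exists z w t, E z w t) ->
    (forall z w t z' w' t' s, 0 <= s -> s <= 1 -> E z w t -> E z' w' t' ->
      E (z + s *: (z' - z)) (w + s *: (w' - w)) (t + s * (t' - t))) ->
    (forall z w t, E z w t -> m <= t + (ip z z + ip w w) / 2) ->
    (forall zn wn tn z w t, (forall n : nat, E (zn n) (wn n) (tn n)) ->
      zn @ \oo --> z -> wn @ \oo --> w -> tn @ \oo --> t -> E z w t) ->
  exists z0 w0 t0, E z0 w0 t0 /\
    forall z w t, E z w t -> t0 <= t + ip z0 (z - z0) + ip w0 (w - w0).
Proof.
move=> [ze [we [te Ee]]] cvxE bndE clE.
pose q (z w : H) (t : R) := t + (ip z z + ip w w) / 2.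
pose S := [set r | exists z w t, E z w t /\ r = q z w t].
have S_inf : has_inf S.
  split; first by exists (q ze we te), ze, we, te.
  by exists m => _ [z [w [t [Ezwt ->]]]]; exact: bndE.
set m0 := inf S.
have m0le z w t : E z w t -> m0 <= q z w t.
  by move=> Ezwt; apply: ge_inf; [exact: S_inf.2|exists z, w, t].
have approx (n : nat) : exists p : H * H * R,
    E p.1.1 p.1.2 p.2 /\ q p.1.1 p.1.2 p.2 < m0 + n.+1%:R^-1.
  have n0 : 0 < n.+1%:R^-1 :> R by rewrite invr_gt0.
  have [_ [z [w [t [Ezwt ->]]]] lt_q] := inf_adherent n0 S_inf.
  by exists (z, w, t).
have [p hp] := choice approx.
pose zn n := (p n).1.1; pose wn n := (p n).1.2; pose tn n := (p n).2.
have En n : E (zn n) (wn n) (tn n) by case: (hp n).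
have qn n : q (zn n) (wn n) (tn n) < m0 + n.+1%:R^-1 by case: (hp n).
(* Parallelogram identity: the midpoint has value at least [m0], which is the mean of the two values
   minus an eighth of this squared distance. *)
have dist i j : ip (zn i - zn j) (zn i - zn j) + ip (wn i - wn j) (wn i - wn j)
    <= 4 * (i.+1%:R^-1 + j.+1%:R^-1).
  have h2 : (0 : R) <= 2^-1 by rewrite invr_ge0.
  have h21 : 2^-1 <= (1 : R) by rewrite invf_le1 // ler1n.
  have := m0le _ _ _ (cvxE _ _ _ _ _ _ _ h2 h21 (En i) (En j)).
  have := qn i; have := qn j; rewrite /q !ipE.
  rewrite (ipC (zn j) (zn i)) (ipC (wn j) (wn i)).
  move: (i.+1%:R^-1) (j.+1%:R^-1) => a b. lra.
have [z0 zcvg] : exists l : H, zn @ \oo --> l.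
  apply: (@cvg_of_sqr_dist zn 4) => i j; apply: le_trans (dist i j).
  by rewrite lerDl ip_ge0.
have [w0 wcvg] : exists l : H, wn @ \oo --> l.
  apply: (@cvg_of_sqr_dist wn 4) => i j; apply: le_trans (dist i j).
  by rewrite lerDr ip_ge0.
(* The height forced by the limit: [q] tends to [m0] and its quadratic part converges. *)
pose t0 := m0 - (ip z0 z0 + ip w0 w0) / 2.
have qcvg : q (zn n) (wn n) (tn n) @[n --> \oo] --> m0.
  apply: (@squeeze_cvgr _ _ _ _ (fun=> m0) (fun n => m0 + n.+1%:R^-1)).
  - by near=> n; rewrite m0le ?En //= ltW ?qn.
  - exact: cvg_cst.
  - rewrite -[X in _ --> X]addr0; apply: cvgD; first exact: cvg_cst.
    exact: cvg_harmonic.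
have tcvg : tn @ \oo --> t0.
  have -> : tn = (fun n => q (zn n) (wn n) (tn n) -
      (ip (zn n) (zn n) + ip (wn n) (wn n)) / 2).
    by apply/funext => n; rewrite /q addrK.
  by apply: cvgB => //; apply: cvgMl; apply: cvgD; exact: cvg_ip.
have E0 : E z0 w0 t0 by exact: clE En zcvg wcvg tcvg.
exists z0, w0, t0; split=> // z w t Ezwt.
(* [L] is the slope at the minimiser towards [(z, w, t)]; at parameter [s] the value is
   [m0 + s (L + s K)]. If [L < 0], the [s] chosen below turns the bracket into
   [L (1 - L) / (K - L + 1) < 0], against minimality. *)
set L := t - t0 + ip z0 (z - z0) + ip w0 (w - w0).
suff : 0 <= L by rewrite /L; lra.
rewrite leNgt; apply/negP => L0.
set K := (ip (z - z0) (z - z0) + ip (w - w0) (w - w0)) / 2.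
have K0 : 0 <= K by rewrite divr_ge0 ?addr_ge0 ?ip_ge0.
have D0 : 0 < K - L + 1 by lra.
pose s := - L / (K - L + 1).
have s0 : 0 < s by rewrite divr_gt0 // oppr_gt0.
have s1 : s <= 1 by rewrite ler_pdivrMr //; lra.
have := m0le _ _ _ (cvxE _ _ _ _ _ _ _ (ltW s0) s1 E0 Ezwt).
have -> : q (z0 + s *: (z - z0)) (w0 + s *: (w - w0)) (t0 + s * (t - t0)) =
    m0 + s * (L + s * K).
  by rewrite /q /L /K /t0 !ipE (ipC z z0) (ipC w w0); field.
rewrite lerDl pmulr_rge0 //.
have -> : L + s * K = L * (1 - L) / (K - L + 1) by rewrite /s; field; lra.
rewrite leNgt => /negP; apply.
by rewrite pmulr_llt0 ?invr_gt0 // pmulr_llt0 //; lra.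
Unshelve. all: by end_near.
Qed.

(** * Riesz representation and weak limits along ultrafilters *)

(** The representing vector minimises [|z|^2 / 2 - l z]. Optimality yields only [l y <= ip z0 y];
    applying it to [- y] gives equality. *)
Lemma riesz (l : H -> R) (M : R) :
    {morph l : x y / x + y} -> (forall a x, l (a *: x) = a * l x) ->
    (forall y, l y <= M * `|y|) ->
  exists p, forall y, l y = ip p y.
Proof.
move=> lD lZ lM.
have lN y : l (- y) = - l y by rewrite -scaleN1r lZ mulN1r.
have [||||z0 [w0 [t0 [E0 opt]]]] :=
    @regularized_min (fun z _ t => - l z <= t) (- M ^+ 2 / 2).
- by exists 0, 0, (- l 0).
- move=> z w t z' w' t' s s0 s1 h h'; rewrite lD lZ lD lN.
  have : 0 <= s * (t' + l z') by rewrite mulr_ge0 //; lra.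
  have : 0 <= (1 - s) * (t + l z) by rewrite mulr_ge0 //; lra.
  lra.
- move=> z w t h; have := ip_ge0 w; have := lM z.
  rewrite !ip_norm; have := sqr_ge0 (`|z| - M); lra.
- move=> zn wn tn z w t h zcvg _ tcvg.
  have lcvg : - l (zn n) @[n --> \oo] --> - l z.
    apply: cvgN; apply/cvgrPdist_le => e e0.
    (* [M] may be nonpositive; [|M| + 1] is a positive Lipschitz constant for [l]. *)
    have M0 : 0 < `|M| + 1 by rewrite ltr_pwDr.
    have /cvgrPdist_le /(_ (e / (`|M| + 1))) := zcvg.
    rewrite divr_gt0 // => /(_ isT); apply: filterS => n hn.
    have lle y : `|l y| <= (`|M| + 1) * `|y|.
      have hM y' : l y' <= (`|M| + 1) * `|y'|.
        apply: le_trans (lM y') _; rewrite ler_wpM2r //.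
        by rewrite (le_trans (ler_norm M)) // lerDl.
      by rewrite ler_norml hM andbT lerNl -lN -(normrN y) hM.
    rewrite -lN -lD (le_trans (lle _)) //.
    by rewrite mulrC -ler_pdivlMr.
  by apply: (ler_cvg_to lcvg tcvg); apply: nearW => n; exact: h.
exists z0.
have lle y : l y <= ip z0 y.
  have := opt (y + z0) w0 (- l (y + z0)) (lexx _).
  by rewrite lD addrK subrr ip0r; lra.
move=> y; apply/eqP; rewrite eq_le lle /=.
by have := lle (- y); rewrite lN ipE lerN2.
Qed.

(** Compactness of a segment provides a cluster point, and an ultrafilter converges to each of its
    cluster points. *)
Lemma cvg_ultra_bounded (T : Type) (F : set_system T) (a : T -> R) (M : R) :
  UltraFilter F -> (forall k, `|a k| <= M) -> exists l : R, a @ F --> l.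
Proof.
move=> UF aM.
have FM : (a @ F) `[- M, M]%classic.
  rewrite /nbhs /=; apply: (@filterS _ F _ setT) => [k _|]; last exact: filterT.
  by rewrite /= in_itv /= -ler_norml.
have [l [_ cl]] := segment_compact _ FM.
exists l => V lV; have [//|FV] := in_ultra_setVsetC (a @^-1` V) UF.
by have [x [/= h1 h2]] := cl (~` V) V FV lV.
Qed.

(** Stands in for weak sequential compactness: the limits of [ip (f k) y] form a bounded linear
    functional of [y], represented by Riesz. *)
Lemma weak_cvg_ultra (T : topologicalType) (F : set_system T)
    (f : T -> H) (M : R) :
    UltraFilter F -> (forall k, `|f k| <= M) ->
  exists p, forall y, ip (f k) y @[k --> F] --> ip p y.
Proof.
move=> UF fM.
have lim_ex y : exists r : R, ip (f k) y @[k --> F] --> r.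
  apply: (@cvg_ultra_bounded _ _ _ (M * `|y|)) => k.
  by rewrite (le_trans (ip_norm_le _ _)) // ler_wpM2r.
have [l hl] := choice lim_ex.
have lE y r : ip (f k) y @[k --> F] --> r -> l y = r.
  exact: cvg_unique (hl y).
have [p hp] : exists p, forall y, l y = ip p y.
  apply: (@riesz _ M).
  - move=> x y; apply: lE; under eq_fun do rewrite ipDr.
    exact: cvgD.
  - move=> c x; apply: lE; under eq_fun do rewrite ipZr.
    exact: cvgMr.
  - move=> y; apply: (ler_cvg_to (hl y) (cvg_cst (M * `|y|))).
    by apply: nearW => k; rewrite (le_trans (ip_le _ _)) // ler_wpM2r.
by exists p => y; rewrite -hp.
Qed.

(** If [F] missed the preimage of a neighbourhood of [l], an ultrafilter refining [F] restricted to
    the complement would contain both sets. *)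
Lemma cvg_from_ultra (T : Type) (U : topologicalType) (F : set_system T)
    (f : T -> U) (l : U) :
    ProperFilter F ->
    (forall G, UltraFilter G -> F `<=` G -> f @ G --> l) ->
  f @ F --> l.
Proof.
move=> FF hU V lV; apply: contrapT => nFV.
pose D := ~` (f @^-1` V).
have PD : ProperFilter (within D F).
  apply: Build_ProperFilter_ex => P FP.
  apply: contrapT => nP; apply: nFV.
  apply: (@filterS _ F _ [set x | D x -> P x]) FP => x DP.
  by apply: contrapT => nV; apply: nP; exists x; exact: DP.
have [G [UG sFG]] := ultraFilterLemma PD.
have GV : G (f @^-1` V).
  apply: hU lV => // P FP; apply: sFG.
  by apply: filterS FP => x Px _.
have GD : G D by apply: sFG; apply: (@filterS _ F _ setT) => //; exact: filterT.
by have [x [Vfx]] := filter_ex (filterI GV GD); apply.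
Qed.

(** * Minty's theorem and resolvents *)

Lemma maximally_monotone_mem (A : H -> set H) (x u : H) :
    maximally_monotone ip A ->
    (forall p q, A p q -> 0 <= ip (x - p) (u - q)) -> A x u.
Proof.
move=> [monoA maxA] hxu; apply: contrapT => nAxu.
pose B p : set H := A p `|` [set q | p = x /\ q = u].
apply: (maxA B).
  move=> p p' q q' [Apq|[-> ->]] [Apq'|[-> ->]].
  - exact: monoA.
  - by rewrite -[p - x]opprB -[q - u]opprB ipNl ipNr opprK hxu.
  - exact: hxu.
  - by rewrite !subrr ip_ge0.
split; first by move=> p Ap; left.
by move=> /(_ (x, u)) BA; apply/nAxu/BA; right.
Qed.

(* Simons and Zalinescu: minimise the Fitzpatrick function of [A] (whose
   epigraph is [E]) plus half the squared norm; the first-order optimality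
   condition at the minimiser [(z, w)] reads [A (- w) (- z)] and [w = - z]. *)
Lemma minty_origin (A : H -> set H) :
    Defs.monotone ip A ->
    (forall x u, (forall p q, A p q -> 0 <= ip (x - p) (u - q)) -> A x u) ->
  exists z, A z (- z).
Proof.
move=> monoA maxA.
pose E z w (t : R) := forall x u, A x u -> ip z u + ip x w - ip x u <= t.
have EA x u : A x u -> E x u (ip x u).
  by move=> Axu p q Apq; have := monoA _ _ _ _ Axu Apq; rewrite !ipE; lra.
(* Fitzpatrick inequality: if [t < ip z w], then [(z, w)] is monotonically related to the graph,
   hence in it, and testing [E] at that very pair gives [ip z w <= t]. *)
have E_ge z w t : E z w t -> ip z w <= t.
  move=> Ezwt; rewrite leNgt; apply/negP => tlt.
  have Azw : A z w.
    by apply: maxA => p q /Ezwt; rewrite !ipE; lra.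
  by have := Ezwt _ _ Azw; lra.
(* An empty graph would make every pair monotonically related to it, so it would contain
   [(0, 0)]. *)
have [p [q Apq]] : exists p q, A p q.
  apply: contrapT => nA; apply: (nA); exists 0, 0; apply: maxA => p q Apq.
  by exfalso; apply: nA; exists p, q.
have [||||z0 [w0 [t0 [E0 opt]]]] := @regularized_min E 0.
- by exists p, q, (ip p q); exact: EA.
- move=> z w t z' w' t' s s0 s1 h h' x u Axu; rewrite !ipE.
  have := h _ _ Axu; have := h' _ _ Axu; rewrite -subr_ge0 => h1.
  rewrite -subr_ge0 => h2.
  have := mulr_ge0 s0 h1.
  have : 0 <= (1 - s) * (t - (ip z u + ip x w - ip x u)).
    by rewrite mulr_ge0 // subr_ge0.
  lra.
- move=> z w t /E_ge; have := ip_ge0 (z + w); rewrite !ipE (ipC w z); lra.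
- move=> zn wn tn z w t h zc wc tc x u Axu.
  have lcvg : ip (zn n) u + ip x (wn n) - ip x u @[n --> \oo] -->
      ip z u + ip x w - ip x u.
    apply: cvgB; last exact: cvg_cst.
    exact: cvgD (cvg_ip zc (cvg_cst u)) (cvg_ip (cvg_cst x) wc).
  by apply: (ler_cvg_to lcvg tc); apply: nearW => n; exact: h.
have t0ge := E_ge _ _ _ E0.
(* Optimality and [ip z0 w0 <= t0] bound the required product below by [|z0 + w0|^2]. Tested at the
   pair [(- w0, - z0)] itself, they then force [z0 + w0 = 0]. *)
have Awz : A (- w0) (- z0).
  apply: maxA => x u Axu; have := opt _ _ _ (EA _ _ Axu).
  have := ip_ge0 (z0 + w0).
  rewrite !ipE (ipC w0 z0) (ipC w0 u) (ipC x z0); lra.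
have := opt _ _ _ (EA _ _ Awz); rewrite !ipE (ipC w0 z0) => opt0.
have /ip_eq0/eqP : ip (z0 + w0) (z0 + w0) <= 0 by rewrite !ipE (ipC w0 z0); lra.
rewrite addr_eq0 => /eqP z0E.
by exists z0; move: Awz; rewrite -z0E.
Qed.

(** Reduces to the origin through [A' = c A - w], which inherits monotonicity and maximality. *)
Lemma minty (A : H -> set H) (c : R) (w : H) :
  maximally_monotone ip A -> 0 < c -> exists z, A z (c^-1 *: (w - z)).
Proof.
move=> Amax c0; pose A' z : set H := [set q | A z (c^-1 *: (w + q))].
have c0' : 0 < c^-1 by rewrite invr_gt0.
have [z zP] : exists z, A' z (- z).
  apply: minty_origin.
    move=> x y u v Axu Ayv; have := Amax.1 _ _ _ _ Axu Ayv.
    by rewrite -scalerBr opprD addrACA subrr add0r ipZr pmulr_rge0.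
  move=> x u h; apply: (maximally_monotone_mem Amax) => p q Apq.
  have := h p (c *: q - w); rewrite /A' /= addrC subrK scalerA mulVf ?gt_eqF //.
  rewrite scale1r => /(_ Apq).
  suff -> : u - (c *: q - w) = c *: (c^-1 *: (w + u) - q).
    by rewrite ipZr pmulr_rge0.
  rewrite scalerBr scalerA divff ?gt_eqF // scale1r opprB addrA.
  by rewrite addrC -!addrA addrCA addrA addrC.
by exists z.
Qed.

Lemma resolventP (A : H -> set H) (c : R) (x p : H) :
  0 < c -> resolvent c A x p <-> A p (c^-1 *: (x - p)).
Proof.
move=> c0; split.
  move=> [_ -> [_ [a Aa <-] <-]].
  by rewrite /= addrC addKr scalerA mulVf ?gt_eqF // scale1r.
move=> Ap; exists p => //; exists (x - p); last by rewrite addrC subrK.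
by exists (c^-1 *: (x - p)) => //; rewrite scalerA divff ?gt_eqF // scale1r.
Qed.

Lemma J_mem (A : H -> set H) (c : R) (x : H) :
  maximally_monotone ip A -> 0 < c -> A (J c A x) (c^-1 *: (x - J c A x)).
Proof.
move=> Amax c0; apply/resolventP => //; apply: xgetPex.
by have [z Az] := minty x Amax c0; exists z; apply/resolventP.
Qed.

Lemma J_eq (A : H -> set H) (c : R) (x p : H) :
  maximally_monotone ip A -> 0 < c -> A p (c^-1 *: (x - p)) -> J c A x = p.
Proof.
move=> Amax c0 Ap.
have := Amax.1 _ _ _ _ (J_mem x Amax c0) Ap.
rewrite -scalerBr ipZr pmulr_rge0 ?invr_gt0 // => h.
apply/eqP; rewrite -subr_eq0; apply/eqP/ip_eq0.
by move: h; rewrite !ipE; lra.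
Qed.

(** * Limit tools, firm nonexpansiveness and Opial's argument *)

Lemma ip_sqr_le (x y : H) : ip x x <= ip x y -> `|x| <= `|y|.
Proof.
move=> h; have [->|x0] := eqVneq x 0; first by rewrite normr0.
have x_gt0 : 0 < `|x| by rewrite normr_gt0.
rewrite -(ler_pM2l x_gt0); apply: le_trans (ip_le x y).
by rewrite -expr2 -ip_norm.
Qed.

Lemma cvg_ip_bounded0 (T : Type) (F : set_system T) {FF : Filter F}
    (f g : T -> H) (M : R) :
    (forall k, `|f k| <= M) -> g @ F --> (0 : H) ->
  ip (f k) (g k) @[k --> F] --> (0 : R).
Proof.
move=> fM g0; apply: norm_cvg0.
have Mg0 : M * `|g k| @[k --> F] --> (0 : R).
  by rewrite -(mulr0 M); apply: cvgMr; rewrite -(@normr0 _ H); exact: cvg_norm.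
apply: (squeeze_cvgr _ (cvg_cst 0) Mg0).
apply: nearW => k; rewrite normr_ge0 /=.
by rewrite (le_trans (ip_norm_le _ _)) // ler_wpM2r.
Qed.

Lemma cvg_ip_weak_strong (T : Type) (F : set_system T) {FF : Filter F}
    (f g : T -> H) (a b : H) (M : R) :
    (forall k, `|f k| <= M) -> (forall y, ip (f k) y @[k --> F] --> ip a y) ->
    g @ F --> b ->
  ip (f k) (g k) @[k --> F] --> ip a b.
Proof.
move=> fM fa gb.
have fgE k : ip (f k) (g k) = ip (f k) (g k - b) + ip (f k) b.
  by rewrite -ipDr subrK.
under eq_fun do rewrite fgE.
rewrite -[ip a b]add0r; apply: cvgD; last exact: fa.
by apply: (cvg_ip_bounded0 fM); apply/subr_cvg0.
Qed.

Lemma cvg0_of_sqr (T : Type) (F : set_system T) {FF : Filter F} (f : T -> H) :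
  ip (f k) (f k) @[k --> F] --> (0 : R) -> f @ F --> (0 : H).
Proof.
move=> ff0; apply/cvgr0Pnorm_lt => e e0.
have /cvgr0Pnorm_lt /(_ _ (exprn_gt0 2 e0)) := ff0.
apply: filterS => k; rewrite ger0_norm ?ip_ge0 // ip_norm.
by rewrite ltr_pXn2r ?nnegrE ?(ltW e0).
Qed.

(** Take the modulus on the bounded set formed by the [f k] and [l]: whenever [|f k - l| >= e], the
    product is at least [phi e > 0], which eventually fails. *)
Lemma uniformly_monotone_cvg (M : H -> set H) (f g : nat -> H) (l m : H)
    (c : R) :
    uniformly_monotone_on_bounded ip M -> M l m ->
    (forall k, M (f k) (g k)) -> (forall k, `|f k| <= c) ->
    ip (f k - l) (g k - m) @[k --> \oo] --> (0 : R) ->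
  f @ \oo --> l.
Proof.
move=> uniM Mlm Mfg fc gap0.
pose C := range f `|` [set l].
have [phi [phi_ge0 phi_mono phi0] phiM] : exists2 phi, modulus phi &
    forall x y u v, C x -> C y -> M x u -> M y v ->
      phi `|x - y| <= ip (x - y) (u - v).
  apply: uniM.
    exists (Num.max c `|l|); split; first exact: num_real.
    move=> d cd y [[k _ <-]|->] /=; apply: ltW; apply: le_lt_trans cd;
      by rewrite le_max ?fc ?lexx ?orbT.
  by move=> y [[k _ <-]|->]; [exists (g k)|exists m].
apply/subr_cvg0/cvgr0Pnorm_lt => e e0.
have phie : 0 < phi e.
  rewrite lt_def phi_ge0 ?ltW // andbT; apply/eqP => /phi0 => /(_ (ltW e0)) eE.
  by rewrite eE ltxx in e0.
have /cvgr0Pnorm_lt /(_ _ phie) := gap0.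
apply: filterS => k hk; rewrite ltNge; apply/negP => ek.
have := phiM _ _ _ _ (or_introl (imageP f (I : [set: nat] k))) (or_intror erefl)
  (Mfg k) Mlm.
have := phi_mono _ _ (ltW e0) ek; have := le_lt_trans (ler_norm _) hk; lra.
Qed.

Lemma J_firm (A : H -> set H) (c : R) (x y : H) :
  maximally_monotone ip A -> 0 < c ->
  0 <= ip (J c A x - J c A y) ((x - J c A x) - (y - J c A y)).
Proof.
move=> Amax c0.
have := Amax.1 _ _ _ _ (J_mem x Amax c0) (J_mem y Amax c0).
by rewrite -scalerBr ipZr pmulr_rge0 ?invr_gt0.
Qed.

Lemma J_nonexpansive (A : H -> set H) (c : R) (x y : H) :
  maximally_monotone ip A -> 0 < c -> `|J c A x - J c A y| <= `|x - y|.
Proof.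
move=> Amax c0; apply: ip_sqr_le; have := J_firm x y Amax c0.
by rewrite !ipE; lra.
Qed.

(** Opial: the distances to [p] and to [q] both converge, hence so does [ip (x k) (q - p)] along
    [\oo]. Both filters see this one limit, so [ip p (q - p) = ip q (q - p)]. *)
Lemma fejer_ultra_limits_eq (x : nat -> H) (C : set H) (F G : set_system nat)
    {FF : ProperFilter F} {GG : ProperFilter G} (p q : H) :
    \oo `<=` F -> \oo `<=` G ->
    (forall c, C c -> forall k, `|x k.+1 - c| <= `|x k - c|) ->
    C p -> C q ->
    (forall y, ip (x k) y @[k --> F] --> ip p y) ->
    (forall y, ip (x k) y @[k --> G] --> ip q y) ->
  p = q.
Proof.
move=> oF oG fejer Cp Cq xp xq.
have dist_cvg c : C c -> exists l : R, `|x k - c| @[k --> \oo] --> l.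
  move=> Cc; apply/cvg_ex; apply: nonincreasing_is_cvgn.
    by apply/nonincreasing_seqP => k; exact: fejer.
  by exists 0 => _ [k _ <-]; exact: normr_ge0.
have [l hl] := dist_cvg p Cp; have [l' hl'] := dist_cvg q Cq.
have lim_ip : ip (x k) (q - p) @[k --> \oo] -->
    (l * l - l' * l' + (ip q q - ip p p)) / 2.
  have ipE' k : ip (x k) (q - p) = (`|x k - p| * `|x k - p| -
      `|x k - q| * `|x k - q| + (ip q q - ip p p)) / 2.
    by rewrite -!expr2 -!ip_norm !ipE (ipC p) (ipC q (x k)); lra.
  under eq_fun do rewrite ipE'.
  apply: cvgMl; apply: cvgD; last exact: cvg_cst.
  by apply: cvgB; apply: cvgM.
have lim_p : ip p (q - p) = (l * l - l' * l' + (ip q q - ip p p)) / 2.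
  apply: (cvg_unique (@Rhausdorff R) (xp (q - p))).
  move: lim_ip; exact: (cvg_trans (cvg_app _ oF)).
have lim_q : ip q (q - p) = (l * l - l' * l' + (ip q q - ip p p)) / 2.
  apply: (cvg_unique (@Rhausdorff R) (xq (q - p))).
  move: lim_ip; exact: (cvg_trans (cvg_app _ oG)).
apply/esym/eqP; rewrite -subr_eq0; apply/eqP/ip_eq0.
by rewrite ipDl ipNl lim_p lim_q subrr.
Qed.

(** * The Davis-Yin operator *)

Section DavisYin.
Context {A B : H -> set H} {T : H -> H} {beta gamma : R}.
Context (A_max : maximally_monotone ip A) (B_max : maximally_monotone ip B).
Context (beta_gt0 : 0 < beta) (T_coco : cocoercive ip beta T).
Context (gamma_gt0 : 0 < gamma).

Local Notation U := (J gamma A).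
Local Notation Omega := (Omega gamma A B T).
Local Notation Z := (zer (op_add (op_add A B) (op_of_fun T))).

Definition forward (x : H) : H := 2 *: U x - x - gamma *: T (U x).
Definition backward (x : H) : H := J gamma B (forward x).
Local Notation V := backward.
Definition residual (x : H) : H := U x - V x.

Lemma subrACA (a b c d : H) : (a - b) - (c - d) = (a - c) - (b - d).
Proof. by rewrite !opprD addrACA. Qed.

(** This is [gamma] times the monotonicity product of [A] at the two resolvent points, so its
    vanishing along the iterates can feed uniform monotonicity. *)
Definition gapA (x y : H) : R :=
  ip (U x - U y) ((x - U x) - (y - U y)).

Definition gapB (x y : H) : R :=
  ip (V x - V y) ((forward x - V x) - (forward y - V y)).

Lemma gapA_ge0 (x y : H) : 0 <= gapA x y.
Proof. exact: J_firm. Qed.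

Lemma gapB_ge0 (x y : H) : 0 <= gapB x y.
Proof. exact: J_firm. Qed.

(** The reflection [2 U x - x] inside [forward] makes the cross terms complete the square of [D]. *)
Lemma gap_sum (x y : H) (D := residual x - residual y) :
  gapA x y + gapB x y =
    ip (x - y) D - ip D D - gamma * ip (V x - V y) (T (U x) - T (U y)).
Proof.
rewrite /gapA /gapB (subrACA x) (subrACA (forward x)).
have -> : D = (U x - U y) - (V x - V y) by exact: subrACA.
have -> : forward x - forward y =
    2 *: (U x - U y) - (x - y) - gamma *: (T (U x) - T (U y)).
  by rewrite !scalerBr /forward (subrACA (2 *: U x - x)) (subrACA (2 *: U x)).
move: (U x - U y) (V x - V y) (x - y) (T (U x) - T (U y)) => du dv dx dT.
by rewrite !ipE (ipC dv du) (ipC du dx) (ipC dv dx); ring.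
Qed.

Lemma gap_sum_le (x y : H) (D := residual x - residual y)
    (dT := T (U x) - T (U y)) :
  gapA x y + gapB x y <=
    ip (x - y) D - ip D D + gamma * ip D dT - gamma * beta * ip dT dT.
Proof.
rewrite gap_sum -/D -/dT; have := T_coco (U x) (U y); rewrite -/dT -ip_norm.
rewrite -(ler_pM2l gamma_gt0) => coco.
have -> : V x - V y = (U x - U y) - D.
  by rewrite /D /residual (subrACA (U x) (V x)) subKr.
by rewrite (ipDl (U x - U y)) (ipNl D); lra.
Qed.

Lemma residual_coco (x y : H) (D := residual x - residual y) :
  (2 - gamma / (2 * beta)) * ip D D <= 2 * ip (x - y) D.
Proof.
have /= := gap_sum_le x y; rewrite -/D.
have := gapA_ge0 x y; have := gapB_ge0 x y.
set dT := T _ - _; clearbody D dT.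
(* Young's inequality, weighted so that the [dT] square is absorbed entirely by cocoercivity. *)
have : 0 <= gamma / (4 * beta) * ip
      (D - (2 * beta) *: dT) (D - (2 * beta) *: dT).
  by rewrite mulr_ge0 ?ip_ge0 // divr_ge0 ?mulr_ge0 // ltW.
have -> : gamma / (4 * beta) * ip
      (D - (2 * beta) *: dT) (D - (2 * beta) *: dT) =
    gamma / (2 * beta) * ip D D / 2 - gamma * ip D dT + gamma * beta * ip dT dT.
  by rewrite !ipE (ipC dT D); field; rewrite gt_eqF.
lra.
Qed.

Lemma T_gap_le (x y : H) (D := residual x - residual y)
    (dT := T (U x) - T (U y)) :
  ip dT dT <=
    2 / (gamma * beta) * (ip (x - y) D + gamma / (2 * beta) * ip D D).
Proof.
have /= := gap_sum_le x y; rewrite -/D -/dT.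
have := gapA_ge0 x y; have := gapB_ge0 x y; clearbody D dT.
(* This weight uses only half of the cocoercivity term; the other half bounds [dT]. *)
have : 0 <= gamma / (2 * beta) * ip (D - beta *: dT) (D - beta *: dT).
  by rewrite mulr_ge0 ?ip_ge0 // divr_ge0 ?mulr_ge0 // ltW.
have -> : gamma / (2 * beta) * ip (D - beta *: dT) (D - beta *: dT) =
    gamma / (2 * beta) * ip D D - gamma * ip D dT + gamma * beta * ip dT dT / 2.
  by rewrite !ipE (ipC dT D); field; rewrite gt_eqF.
have := ip_ge0 D => h1 h2 h3 h4 h5.
have c0 : 0 < 2 / (gamma * beta) by rewrite divr_gt0 ?mulr_gt0.
have -> : ip dT dT = 2 / (gamma * beta) * (gamma * beta * ip dT dT / 2).
  by field; rewrite !gt_eqF.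
by rewrite ler_pM2l //; lra.
Qed.

Lemma Omega_residual (x : H) : Omega x <-> residual x = 0.
Proof.
rewrite /residual; split=> [h|/eqP]; first by apply/eqP; rewrite subr_eq0 {1}h.
by rewrite subr_eq0 => /eqP.
Qed.

Lemma Omega_zer (x : H) : Omega x -> Z (U x).
Proof.
move=> xO; have := J_mem (forward x) B_max gamma_gt0.
have -> : J gamma B (forward x) = U x by rewrite /forward -xO.
move=> BU; have AU := J_mem x A_max gamma_gt0.
(* The elements of [A (U x)] and [B (U x)] supplied by the two resolvents add up to [- T (U x)]. *)
exists (gamma^-1 *: (x - U x) + gamma^-1 *: (forward x - U x)).
  exists (gamma^-1 *: (x - U x)) => //.
  by exists (gamma^-1 *: (forward x - U x)).
exists (T (U x)) => //; apply: ip_inj => y.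
by rewrite ip0l /forward !ipE; field; rewrite gt_eqF.
Qed.

(** From [a + b + T z = 0] with [a] in [A z] and [b] in [B z], take [x = z + gamma a]; then
    [forward x = z + gamma b], so both resolvents return [z]. *)
Lemma zer_Omega (z : H) : Z z -> exists2 x, Omega x & U x = z.
Proof.
move=> [_ [a Aza [b Bzb <-]] [_ -> abT]].
have Ux : U (z + gamma *: a) = z.
  apply: J_eq => //; suff -> : gamma^-1 *: (z + gamma *: a - z) = a by [].
  by apply: ip_inj => y; rewrite !ipE; field; rewrite gt_eqF.
exists (z + gamma *: a) => //; apply/Omega_residual; apply/eqP.
rewrite subr_eq0 Ux eq_sym; apply/eqP/J_eq => //; rewrite /forward Ux.
suff -> : gamma^-1 *: (2 *: z - (z + gamma *: a) - gamma *: T z - z) = b by [].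
apply: ip_inj => y.
have : ip (a + b + T z) y = 0 by rewrite abT ip0l.
rewrite !ipE => h; have -> : ip b y = - ip a y - ip (T z) y by lra.
by field; rewrite gt_eqF.
Qed.

(** * The relaxed iteration: Fejer monotonicity and vanishing residual *)

Context {lambda : nat -> R} {x : nat -> H}.
Local Notation rho := (2 - gamma / (2 * beta)).
Context (lambda_bnd : forall k, 0 < lambda k <= rho).
Context (lambda_sum :
  (\sum_(0 <= k <oo) (lambda k * (rho - lambda k))%:E)%E = +oo%E).
Context (x_rec : forall k, x k.+1 = x k - lambda k *: residual (x k)).
Context (Omega_neq0 : Omega !=set0).

Lemma fejer_decrease (y : H) (k : nat) (D := residual (x k)) : Omega y ->
  ip (x k.+1 - y) (x k.+1 - y) <=
    ip (x k - y) (x k - y) - lambda k * (rho - lambda k) * ip D D.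
Proof.
move=> /Omega_residual yO; have /= := residual_coco (x k) y.
rewrite yO subr0 -/D x_rec -/D (addrAC (x k)).
move: (x k - y) => dx; clearbody D.
have /andP[l0 _] := lambda_bnd k; rewrite -(ler_pM2l l0).
by rewrite !ipE (ipC D dx); lra.
Qed.

Lemma fejer_omega (y : H) (k : nat) : Omega y -> `|x k.+1 - y| <= `|x k - y|.
Proof.
move=> yO; rewrite -(@ler_pXn2r _ 2) ?nnegrE // -!ip_norm.
apply: le_trans (fejer_decrease k yO) _; rewrite lerBlDr lerDl.
have /andP[l0 l1] := lambda_bnd k.
by rewrite !mulr_ge0 ?ip_ge0 ?subr_ge0 // ltW.
Qed.

Lemma dist_omega_le (y : H) (k : nat) : Omega y -> `|x k - y| <= `|x 0 - y|.
Proof.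
move=> yO; elim: k => // k; exact/le_trans/fejer_omega.
Qed.

(** With [d] the increment of the residual [D], the key inequality on consecutive iterates reads
    [rho |d|^2 <= - 2 lambda_k ip D d]; since [lambda_k <= rho], this gives
    [2 ip D d + |d|^2 <= 0]. *)
Lemma residual_decrease (k : nat) :
  ip (residual (x k.+1)) (residual (x k.+1)) <=
    ip (residual (x k)) (residual (x k)).
Proof.
have /andP[l0 l1] := lambda_bnd k.
have /= := residual_coco (x k.+1) (x k).
have -> : x k.+1 - x k = - (lambda k *: residual (x k)).
  by rewrite x_rec addrAC subrr add0r.
have : residual (x k.+1) =
    residual (x k) + (residual (x k.+1) - residual (x k)).
  by rewrite addrC subrK.
move: (residual (x k)) (residual (x k.+1) - residual (x k)) => D d -> h.
have h2 : 0 <= (rho - lambda k) * ip d d by rewrite mulr_ge0 ?ip_ge0 ?subr_ge0.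
rewrite -(ler_pM2l l0); move: h; rewrite !ipE (ipC d D); lra.
Qed.

(** Otherwise the telescoped Fejer decrease would bound the partial sums of the divergent series by
    [|x 0 - y|^2 / e]. *)
Lemma residual_small (e : R) : 0 < e ->
  exists k, ip (residual (x k)) (residual (x k)) < e.
Proof.
move=> e0; apply: contrapT => nex.
have ge_e k : e <= ip (residual (x k)) (residual (x k)).
  by rewrite leNgt; apply/negP => h; apply: nex; exists k.
have [y yO] := Omega_neq0.
have c0 k : 0 <= lambda k * (rho - lambda k).
  have /andP[l0 l1] := lambda_bnd k.
  by rewrite mulr_ge0 ?subr_ge0 // ltW.
have psum n : e * \sum_(0 <= k < n) (lambda k * (rho - lambda k)) <=
    ip (x 0 - y) (x 0 - y) - ip (x n - y) (x n - y).
  elim: n => [|n IH]; first by rewrite big_nil mulr0 subrr.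
  rewrite big_nat_recr //= mulrDr.
  have /= := fejer_decrease n yO; have := ler_wpM2l (c0 n) (ge_e n); lra.
have : (\sum_(0 <= k <oo) (lambda k * (rho - lambda k))%:E <=
    (ip (x 0 - y) (x 0 - y) / e)%:E)%E.
  apply: lime_le.
    by apply: is_cvg_nneseries => n _ _; rewrite lee_fin.
  apply: nearW => n; rewrite sumEFin lee_fin ler_pdivlMr // mulrC.
  by apply: le_trans (psum n) _; rewrite gerBl ip_ge0.
by rewrite lambda_sum leye_eq.
Qed.

Lemma residual_cvg0 : residual (x k) @[k --> \oo] --> (0 : H).
Proof.
apply/cvgr0Pnorm_lt => e e0.
have [N hN] := residual_small (exprn_gt0 2 e0).
exists N => // n /= Nn; rewrite -(@ltr_pXn2r _ 2) ?nnegrE ?(ltW e0) // -ip_norm.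
apply: le_lt_trans hN; rewrite -(subnK Nn); elim: (n - N)%N => // m.
by apply: le_trans; rewrite addSn; exact: residual_decrease.
Qed.

(** * Boundedness, then weak and strong convergence of the iterates *)

Lemma x_bounded : exists M, forall k, `|x k| <= M.
Proof.
have [y yO] := Omega_neq0; exists (`|x 0 - y| + `|y|) => k.
rewrite -[x k](subrK y) (le_trans (ler_normD _ _)) // lerD2r.
exact: dist_omega_le.
Qed.

Lemma U_bounded : exists M, forall k, `|U (x k)| <= M.
Proof.
have [y yO] := Omega_neq0; exists (`|x 0 - y| + `|U y|) => k.
rewrite -[U (x k)](subrK (U y)) (le_trans (ler_normD _ _)) // lerD2r.
apply: le_trans (dist_omega_le k yO); exact: J_nonexpansive.
Qed.

Lemma V_bounded : exists M, forall k, `|V (x k)| <= M.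
Proof.
have [M UM] := U_bounded; exists (M + `|residual (x 0)|) => k.
have -> : V (x k) = U (x k) - residual (x k) by rewrite subKr.
rewrite (le_trans (ler_normB _ _)) // lerD //.
elim: k => // k; apply: le_trans.
by rewrite -(@ler_pXn2r _ 2) ?nnegrE // -!ip_norm residual_decrease.
Qed.

Lemma T_cvg (y : H) : Omega y -> T (U (x k)) @[k --> \oo] --> T (U y).
Proof.
move=> yO; have D0 := residual_cvg0.
pose b k := 2 / (gamma * beta) * (ip (x k - y) (residual (x k)) +
  gamma / (2 * beta) * ip (residual (x k)) (residual (x k))).
have b0 : b k @[k --> \oo] --> (0 : R).
  rewrite -(mulr0 (2 / (gamma * beta))); apply: cvgMr; rewrite -[0]addr0.
  apply: cvgD; first by apply: cvg_ip_bounded0 D0 => k; exact: dist_omega_le.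
  have -> : 0 = gamma / (2 * beta) * ip (0 : H) (0 : H).
    by rewrite ip0l mulr0.
  by apply: cvgMr; exact: cvg_ip.
suff sqr0 : ip (T (U (x k)) - T (U y)) (T (U (x k)) - T (U y))
    @[k --> \oo] --> (0 : R) by apply/subr_cvg0; exact: cvg0_of_sqr sqr0.
apply: (squeeze_cvgr _ (cvg_cst 0) b0); apply: nearW => k.
have /= := T_gap_le (x k) y.
by rewrite (Omega_residual y).1 // subr0 ip_ge0.
Qed.

(** Both gaps are nonnegative, and their sum is at most [b], obtained by dropping the negative
    squares in [gap_sum_le]; each term of [b] contains the vanishing residual. *)
Lemma gap_cvg0 (y : H) : Omega y ->
  gapA (x k) y @[k --> \oo] --> (0 : R) /\
  gapB (x k) y @[k --> \oo] --> (0 : R).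
Proof.
move=> yO; have D0 := residual_cvg0.
pose b k := ip (x k - y) (residual (x k)) +
  gamma * ip (residual (x k)) (T (U (x k)) - T (U y)).
have b0 : b k @[k --> \oo] --> (0 : R).
  rewrite -[0]addr0; apply: cvgD.
    by apply: cvg_ip_bounded0 D0 => k; exact: dist_omega_le.
  have -> : 0 = gamma * ip (0 : H) (0 : H).
    by rewrite ip0l mulr0.
  by apply: cvgMr; apply: cvg_ip => //; apply/subr_cvg0; exact: T_cvg.
have sum_le k : gapA (x k) y + gapB (x k) y <= b k.
  have /= := gap_sum_le (x k) y; rewrite ((Omega_residual y).1 yO) subr0.
  move/le_trans; apply; rewrite /b lerBlDr addrAC lerBlDr -addrA lerDl.
  by rewrite addr_ge0 ?ip_ge0 // !mulr_ge0 ?ip_ge0 // ltW.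
split; apply: (squeeze_cvgr _ (cvg_cst 0) b0); apply: nearW => k;
  have := sum_le k; have := gapA_ge0 (x k) y; have := gapB_ge0 (x k) y => gB gA;
  by rewrite ?gA ?gB /=; lra.
Qed.

(* The products [ip (u k) (x k)] etc. need not converge, but in the sum of the
   firm nonexpansiveness inequalities of both resolvents they combine into
   [ip (x k) D - ip D D] with [D = u k - v k], which tends to 0. *)
Lemma weak_limit_Omega (G : set_system nat) {GG : ProperFilter G}
    (xb ub t : H) :
    (forall y, ip (x k) y @[k --> G] --> ip xb y) ->
    (forall y, ip (U (x k)) y @[k --> G] --> ip ub y) ->
    residual (x k) @[k --> G] --> (0 : H) -> T (U (x k)) @[k --> G] --> t ->
  Omega xb /\ U xb = ub.
Proof.
move=> xG uG D0 TG.
have [Mx xM] := x_bounded; have [Mu uM] := U_bounded; have [Mv vM] := V_bounded.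
(* Weak-strong closedness of the graph of [T]: cocoercivity passes to the limit as
   [beta |t - T ub|^2 <= 0]. *)
have tE : t = T ub.
  have lim1 : beta * `|T (U (x k)) - T ub| ^+ 2 @[k --> G] -->
      beta * `|t - T ub| ^+ 2.
    rewrite expr2; under eq_fun do rewrite expr2; apply: cvgMr; apply: cvgM;
      by apply: cvg_norm; apply: cvgB => //; exact: cvg_cst.
  have lim2 : ip (U (x k) - ub) (T (U (x k)) - T ub) @[k --> G] -->
      ip (0 : H) (t - T ub).
    apply: (@cvg_ip_weak_strong _ _ _ _ _ _ _ (Mu + `|ub|)).
    - by move=> k; rewrite (le_trans (ler_normB _ _)) // lerD2r.
    - move=> y; under eq_fun do rewrite ipDl ipNl.
      have -> : ip 0 y = ip ub y - ip ub y by rewrite subrr ip0l.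
      by apply: cvgB; [exact: uG|exact: cvg_cst].
    - by apply: cvgB => //; exact: cvg_cst.
  have : beta * `|t - T ub| ^+ 2 <= ip (0 : H) (t - T ub).
    by apply: (ler_cvg_to lim1 lim2); apply: nearW => k; exact: T_coco.
  rewrite ip0l -ip_norm pmulr_rle0 // => /ip_eq0/eqP.
  by rewrite subr_eq0 => /eqP.
have vE k : V (x k) = U (x k) - residual (x k) by rewrite subKr.
have vG y : ip (V (x k)) y @[k --> G] --> ip ub y.
  under eq_fun do rewrite vE ipDl ipNl.
  have -> : ip ub y = ip ub y - ip 0 y by rewrite ip0l subr0.
  by apply: cvgB; [exact: uG|apply: cvg_ip => //; exact: cvg_cst].
pose wb := 2 *: ub - xb - gamma *: t.
have wG y : ip (forward (x k)) y @[k --> G] --> ip wb y.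
  rewrite /wb /forward !ipE; under eq_fun do rewrite !ipE.
  apply: cvgB; first by apply: cvgB => //; apply: cvgMr.
  by apply: cvgMr; apply: cvg_ip => //; exact: cvg_cst.
pose p := U xb; pose r := J gamma B wb.
(* The sum of the firm nonexpansiveness products at [(x k, xb)] and [(forward (x k), wb)], regrouped
   into terms that all converge. *)
pose S k := ip (x k) (residual (x k)) - ip (residual (x k)) (residual (x k))
  - gamma * ip (V (x k)) (T (U (x k)))
  - (ip (U (x k)) (xb - p) + (ip (x k) p - ip (U (x k)) p))
  - (ip (V (x k)) (wb - r) + (ip (forward (x k)) r - ip (V (x k)) r))
  + (ip p (xb - p) + ip r (wb - r)).
pose S_lim := ip xb 0 - ip (0 : H) 0 - gamma * ip ub t
  - (ip ub (xb - p) + (ip xb p - ip ub p))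
  - (ip ub (wb - r) + (ip wb r - ip ub r)) + (ip p (xb - p) + ip r (wb - r)).
have SG : S k @[k --> G] --> S_lim.
  apply: cvgD; last exact: cvg_cst.
  apply: cvgB; last by apply: cvgD => //; apply: cvgB.
  apply: cvgB; last by apply: cvgD => //; apply: cvgB.
  apply: cvgB; last by apply: cvgMr; exact: (cvg_ip_weak_strong vM vG TG).
  by apply: cvgB; [exact: (cvg_ip_weak_strong xM xG D0)|exact: cvg_ip].
have S_ge0 k : 0 <= S k.
  have := J_firm (x k) xb A_max gamma_gt0.
  have := J_firm (forward (x k)) wb B_max gamma_gt0.
  rewrite -[J gamma B (forward (x k))]/(V (x k)) -/p -/r.
  have : ip (V (x k)) (forward (x k)) = 2 * ip (V (x k)) (U (x k)) -
      ip (V (x k)) (x k) - gamma * ip (V (x k)) (T (U (x k))).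
    by rewrite /forward !ipE.
  rewrite /S /residual; clearbody p r wb.
  move: (T (U (x k))) => Tu; move: (U (x k)) (V (x k)) (forward (x k)) => u v w.
  move: (x k) => xk; rewrite !ipE.
  rewrite (ipC p xk) (ipC p u) (ipC r v) (ipC r w) (ipC u xk) (ipC v xk).
  by rewrite (ipC u v); lra.
have lim_ge0 : 0 <= S_lim.
  by apply: (ler_cvg_to (cvg_cst 0) SG); exact: nearW.
have ubwb : ip ub wb = 2 * ip ub ub - ip ub xb - gamma * ip ub t.
  by rewrite /wb !ipE.
(* [S_lim] is exactly the opposite of this sum of squares. *)
have sqr_le0 : ip (ub - p) (ub - p) + ip (ub - r) (ub - r) <= 0.
  move: lim_ge0; rewrite /S_lim ip0l ip0r; clearbody p r wb; rewrite !ipE.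
  by rewrite (ipC p xb) (ipC p ub) (ipC r wb) (ipC r ub); lra.
have pE : p = ub.
  apply/esym/eqP; rewrite -subr_eq0; apply/eqP/ip_eq0.
  by have := ip_ge0 (ub - r); lra.
have rE : r = ub.
  apply/esym/eqP; rewrite -subr_eq0; apply/eqP/ip_eq0.
  by have := ip_ge0 (ub - p); lra.
split=> //; apply/Omega_residual; rewrite /residual -/p /backward /forward -/p.
by rewrite pE -tE -/wb -/r rE subrr.
Qed.

Lemma iterates_weakly_cvg : exists2 p, Omega p &
  weakly_cvg ip x p /\ weakly_cvg ip (fun k => U (x k)) (U p).
Proof.
have [y0 y0O] := Omega_neq0.
have [Mx xM] := x_bounded; have [Mu uM] := U_bounded.
have ultra_lim (G : set_system nat) : UltraFilter G -> \oo `<=` G ->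
    exists2 p, Omega p & (forall y, ip (x k) y @[k --> G] --> ip p y) /\
      (forall y, ip (U (x k)) y @[k --> G] --> ip (U p) y).
  move=> UG oG.
  have [xb xG] := weak_cvg_ultra UG xM.
  have [ub uG] := weak_cvg_ultra UG uM.
  have D0 : residual (x k) @[k --> G] --> (0 : H).
    by move: residual_cvg0; exact: (cvg_trans (cvg_app _ oG)).
  have TG : T (U (x k)) @[k --> G] --> T (U y0).
    by move: (T_cvg y0O); exact: (cvg_trans (cvg_app _ oG)).
  have [xbO xbE] := weak_limit_Omega xG uG D0 TG.
  by exists xb => //; rewrite xbE.
(* The candidate [p] is read off one ultrafilter; Opial's argument identifies all other limits with
   it. *)
have [G0 [UG0 oG0]] := ultraFilterLemma (eventually_filter : ProperFilter \oo).
have [p pO [xG0 _]] := ultra_lim G0 UG0 oG0.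
have lim_eq (G : set_system nat) (q : H) : UltraFilter G -> \oo `<=` G ->
    Omega q -> (forall y, ip (x k) y @[k --> G] --> ip q y) -> q = p.
  move=> UG oG qO xG.
  apply: (fejer_ultra_limits_eq oG oG0 _ qO pO xG xG0) => c cO k.
  exact: fejer_omega.
exists p => //; split=> y; apply: cvg_from_ultra => G UG oG;
  have [q qO [xG uG]] := ultra_lim G UG oG;
  by rewrite -(lim_eq G q UG oG qO xG).
Qed.

Lemma backward_cvg (l : H) :
  U (x k) @[k --> \oo] --> l -> V (x k) @[k --> \oo] --> l.
Proof.
move=> Ul; have VE k : V (x k) = U (x k) - residual (x k) by rewrite subKr.
under eq_fun do rewrite VE.
by rewrite -[l]subr0; apply: cvgB => //; exact: residual_cvg0.
Qed.

Lemma iterates_cvg (p : H) :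
    Omega p -> weakly_cvg ip (fun k => U (x k)) (U p) ->
    (uniformly_monotone_on_bounded ip A \/
      uniformly_monotone_on_bounded ip B \/
      (forall z, Z z -> demiregular ip T z)) ->
  U (x k) @[k --> \oo] --> U p.
Proof.
move=> pO Uweak.
have [gA0 gB0] := gap_cvg0 pO.
(* Resolvent memberships carry a factor [gamma^-1], so the monotonicity products are [gamma^-1]
   times the gaps. *)
have scaleE a b c d : ip a (gamma^-1 *: (b - c) - gamma^-1 *: d) =
    gamma^-1 * ip a ((b - c) - d) by rewrite -scalerBr ipZr.
have [Mu uM] := U_bounded; have [Mv vM] := V_bounded.
move=> [uniA|[uniB|demi]].
- apply: (uniformly_monotone_cvg uniA (J_mem p A_max gamma_gt0)
    (fun k => J_mem (x k) A_max gamma_gt0) uM).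
  under eq_fun do rewrite scaleE.
  by rewrite -(mulr0 gamma^-1); exact: cvgMr.
(* Uniform monotonicity of [B] controls the backward points; the vanishing residual carries the
   limit over to [U (x k)]. *)
- have Vp : V p = U p.
    by have /Omega_residual/eqP := pO; rewrite subr_eq0 => /eqP.
  have Vcvg : V (x k) @[k --> \oo] --> V p.
    apply: (uniformly_monotone_cvg uniB (J_mem (forward p) B_max gamma_gt0)
      (fun k => J_mem (forward (x k)) B_max gamma_gt0) vM).
    under eq_fun do rewrite scaleE.
    by rewrite -(mulr0 gamma^-1); exact: cvgMr.
  have UE k : U (x k) = V (x k) + residual (x k) by rewrite addrC subrK.
  under eq_fun do rewrite UE.
  by rewrite -[U p]addr0 -Vp; apply: cvgD => //; exact: residual_cvg0.
- by apply: (demi _ (Omega_zer pO)) => //; exact: T_cvg.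
Qed.

End DavisYin.

End HilbertSpace.

(** * Transfer to the sequences [x], [u] and [v] *)

Theorem theorem3p3 (R : realType) (H : completeNormedModType R)
  (ip : {dot H for idfun}) (ip_norm : forall x : H, ip x x = `|x| ^+ 2)
  (A B : H -> set H) (T : H -> H) (beta gamma : R) (lambda : nat -> R)
  (x0 : H) (x u v : nat -> H)
  (A_max : maximally_monotone ip A) (B_max : maximally_monotone ip B)
  (beta_gt0 : 0 < beta) (T_coco : cocoercive ip beta T)
  (zer_neq0 : zer (op_add (op_add A B) (op_of_fun T)) !=set0)
  (gamma_bnd : 0 < gamma < 4 * beta)
  (lambda_bnd : forall k, 0 < lambda k <= 2 - gamma / (2 * beta))
  (lambda_sum : (\sum_(0 <= k <oo)
     (lambda k * (2 - gamma / (2 * beta) - lambda k))%:E)%E = +oo%E)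
  (x_init : x 0%N = x0)
  (u_def : forall k, u k = J gamma A (x k))
  (v_def : forall k, v k = J gamma B (2 *: u k - x k - gamma *: T (u k)))
  (x_rec : forall k, x k.+1 = x k + lambda k *: (v k - u k)) :
  let Z := zer (op_add (op_add A B) (op_of_fun T)) in
  fejer_monotone x (Omega gamma A B T) /\
  exists xbar ubar : H,
    (* (i) *)
    ([/\ Omega gamma A B T xbar,
        weakly_cvg ip x xbar,
        weakly_cvg ip u ubar &
        weakly_cvg ip v ubar] /\
     [/\ v k - u k @[k --> \oo] --> (0 : H),
        T (u k) @[k --> \oo] --> T ubar,
        ubar = J gamma A xbar /\
          J gamma A xbar = J gamma B (2 *: ubar - xbar - gamma *: T ubar),
        Z ubar &
        T @` Z = [set T ubar]]) /\
    (* (ii) *)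
    ((uniformly_monotone_on_bounded ip A \/
      uniformly_monotone_on_bounded ip B \/
      (forall z, Z z -> demiregular ip T z)) ->
     u @ \oo --> ubar /\ v @ \oo --> ubar).
Proof.
move=> Z.
have /andP[gamma_gt0 _] := gamma_bnd.
have uE : u = fun k => J gamma A (x k) by apply/funext.
pose D y := @residual _ _ A B T gamma y.
have DE k : u k - v k = D (x k) by rewrite v_def u_def.
have x_rec' k : x k.+1 = x k - lambda k *: D (x k).
  by rewrite x_rec -DE -scalerN opprB.
have Omega_zerP := zer_Omega ip_norm A_max B_max gamma_gt0.
have Omega_neq0 : Omega gamma A B T !=set0.
  by have [z /Omega_zerP [y yO _]] := zer_neq0; exists y.
have D0 : u k - v k @[k --> \oo] --> (0 : H).
  under eq_fun do rewrite DE.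
  exact: (residual_cvg0 ip_norm A_max B_max beta_gt0 T_coco gamma_gt0
    lambda_bnd lambda_sum x_rec' Omega_neq0).
have Tcvg y : Omega gamma A B T y -> T (u k) @[k --> \oo] --> T (J gamma A y).
  rewrite uE; exact: (T_cvg ip_norm A_max B_max beta_gt0 T_coco gamma_gt0
    lambda_bnd lambda_sum x_rec' Omega_neq0).
split.
  split=> // y yO k.
  exact: (fejer_omega ip_norm A_max B_max beta_gt0 T_coco gamma_gt0
    lambda_bnd x_rec').
have [p pO [xp up]] := iterates_weakly_cvg ip_norm A_max B_max beta_gt0 T_coco
  gamma_gt0 lambda_bnd lambda_sum x_rec' Omega_neq0.
have vE k : v k = u k - (u k - v k) by rewrite subKr.
have Zp : Z (J gamma A p) by exact: (Omega_zer ip_norm A_max B_max gamma_gt0).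
exists p, (J gamma A p); split; [split; split=> //|].
- by rewrite uE.
- move=> y; under eq_fun do rewrite vE ipDl ipNl.
  rewrite -[ip (J gamma A p) y]subr0 -[X in _ - X](ip0l (ip := ip) y).
  apply: cvgB; first by rewrite uE.
  by apply: (cvg_ip ip_norm D0); exact: cvg_cst.
- by under eq_fun do rewrite -opprB; rewrite -[0]oppr0; exact: cvgN.
- exact: Tcvg.
(* Every zero is [J gamma A y] for some [y] in [Omega], and [T (u k)] converges to [T (J gamma A y)]
   for each such [y]; uniqueness of limits leaves one value. *)
- apply/seteqP; split=> [_ [z /Omega_zerP [y yO <-] <-]|_ ->].
    exact: (cvg_unique (@norm_hausdorff _ _) (Tcvg y yO) (Tcvg p pO)).
  by exists (J gamma A p).
move=> hyp; rewrite uE.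
have ucvg := iterates_cvg ip_norm A_max B_max beta_gt0 T_coco gamma_gt0
  lambda_bnd lambda_sum x_rec' Omega_neq0 pO up hyp.
split=> //.
have -> : v = fun k => @backward _ _ A B T gamma (x k).
  by apply/funext => k; rewrite v_def u_def.
exact: (backward_cvg ip_norm A_max B_max beta_gt0 T_coco gamma_gt0
    lambda_bnd lambda_sum x_rec' Omega_neq0).
Qed.
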